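(* Let $m,n$ be nonnegative integers. For a shuffle $\mathbf{s}$ of $\mathbf{x}$ and $\mathbf{y}$ let $$B_{\mathbf{s}}=A_a\cup\{\mathbf{b}\in A_b : \mathbf{b}\le\mathbf{s}\}.$$ Then the NBB bases of $\mathbf{y}\in\mathcal{W}_{m,n}$ with respect to the partial order $\unlhd$ on the atoms are exactly the sets $B_{\mathbf{s}}$, where $\mathbf{s}$ ranges over the shuffles of $\mathbf{x}$ and $\mathbf{y}$.
   Context: All words consist of distinct letters; a word is also used to denote its set of letters. For words $\mathbf{u},\mathbf{v}$, the restriction $\mathbf{u}_{\mathbf{v}}$ is the subword of $\mathbf{u}$ whose letters are exactly those of $\mathbf{u}\cap\mathbf{v}$. A shuffle of words $\mathbf{u},\mathbf{v}$ with no common letter is a word $\mathbf{s}$ with letter set $\mathbf{u}\uplus\mathbf{v}$, $\mathbf{s}_{\mathbf{u}}=\mathbf{u}$ and $\mathbf{s}_{\mathbf{v}}=\mathbf{v}$. Fix disjoint words $\mathbf{x}=x_1\cdots x_m$ and $\mathbf{y}=y_1\cdots y_n$. The elements of the poset of shuffles $\mathcal{W}_{m,n}$ are all shuffles of a subword of $\mathbf{x}$ with a subword of $\mathbf{y}$. The order is: $\mathbf{v}\le\mathbf{w}$ if $\mathbf{v}_{\mathbf{x}}\supseteq\mathbf{w}_{\mathbf{x}}$, $\mathbf{v}_{\mathbf{y}}\subseteq\mathbf{w}_{\mathbf{y}}$ (as sets), and the common letters of $\mathbf{v}$ and $\mathbf{w}$ appear in the same order in both, i.e. $\mathbf{v}_{\mathbf{w}}=\mathbf{w}_{\mathbf{v}}$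 (equivalently, $\mathbf{w}$ arises from $\mathbf{v}$ by deleting letters of $\mathbf{x}$ and inserting letters of $\mathbf{y}$). This is a lattice with $\hat 0=\mathbf{x}$ and $\hat 1=\mathbf{y}$. $A_{m,n}$ is the set of atoms of $\mathcal{W}_{m,n}$. An a-atom is an atom obtained from $\mathbf{x}$ by deleting a letter of $\mathbf{x}$; a b-atom is one obtained from $\mathbf{x}$ by inserting a letter of $\mathbf{y}$; $A_a$, $A_b$ are the sets of a-atoms and b-atoms. The partial order $\unlhd$ on $A_{m,n}$ has as its strict relations exactly $\mathbf{a}\lhd\mathbf{b}$ for $\mathbf{a}\in A_a$, $\mathbf{b}\in A_b$. For a finite lattice $L$ with order $\le$ and a partial order $\unlhd$ on its atom set $A(L)$, a nonempty $D\subseteq A(L)$ is bounded below (BB) if for every $d\in D$ there is $a\in A(L)$ with $a\lhd d$ and $a<\bigvee D$. A set $B\subseteq A(L)$ is NBB if it contains no BB subset; an NBB base of $x\in L$ is an NBB set $B$ with $\bigvee B=x$ (where $\bigvee\emptyset=\hat 0$). *)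

(* Defs.v *)
From HB Require Import structures.
From mathcomp Require Import all_boot all_order.

Set Implicit Arguments.
Unset Strict Implicit.
Unset Printing Implicit Defensive.

Import Order.TTheory.

Section NBB.
Local Open Scope order_scope.
Context {disp : Order.disp_t} {L : finTBLatticeType disp}.
Implicit Types (a d x : L) (B D : {set L}).

Definition atoms : {set L} :=
  [set a : L | (\bot < a) && [forall z : L, (\bot < z <= a) ==> (z == a)]].

(* [tle] is the partial order on the atoms; it is only used on [atoms], and its
   strict part is [fun a d => (a != d) && tle a d]. *)
Definition bounded_below (tle : rel L) D : bool :=
  [&& D != set0, D \subset atoms &
    [forall d in D, exists a in atoms,
       [&& a != d, tle a d & a < \join_(e in D) e]]].

Definition nbb (tle : rel L) B : bool :=
  (B \subset atoms) &&
  [forall D : {set L}, (D \subset B) ==> ~~ bounded_below tle D].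

Definition nbb_base (tle : rel L) B x : bool :=
  nbb tle B && (\join_(b in B) b == x).

End NBB.

Section Words.
Variable T : eqType.
Implicit Types (s t u v w x y : seq T) (a b c : T).

Definition restrict u v := [seq c <- u | c \in v].

(* Words have distinct letters, so [perm_eq] says that the letter set of [s] is
   the disjoint union of those of [u] and [v]. *)
Definition is_shuffle u v s :=
  [&& perm_eq s (u ++ v), restrict s u == u & restrict s v == v].

(* A shuffle [w] of a subword of [x] with a subword of [y] determines these
   subwords, as its restrictions to [x] and [y]; see [in_shufflesP]. *)
Definition in_shuffles x y w :=
  [&& subseq (restrict w x) x, subseq (restrict w y) y
    & is_shuffle (restrict w x) (restrict w y) w].

Definition shuffle_le x y v w :=
  [&& all [in restrict v x] (restrict w x),
      all [in restrict w y] (restrict v y)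
    & restrict v w == restrict w v].

Definition insert_at (i : nat) c s := take i s ++ c :: drop i s.

Lemma mem_restrict c u v : (c \in restrict u v) = (c \in v) && (c \in u).
Proof. by rewrite mem_filter. Qed.

Lemma restrict_restrict w x : restrict w (restrict w x) = restrict w x.
Proof. by apply: eq_in_filter => c cw; rewrite mem_restrict cw andbT. Qed.

Lemma in_shufflesE x y w : uniq (x ++ y) ->
  in_shuffles x y w =
  [&& uniq w, all [in x ++ y] w, subseq (restrict w x) x
    & subseq (restrict w y) y].
Proof.
move=> xyU; apply/idP/idP => [/and3P[sx sy /and3P[pw _ _]]|].
  have sxy : subseq (restrict w x ++ restrict w y) (x ++ y) by apply: cat_subseq.
  rewrite (perm_uniq pw) (subseq_uniq sxy xyU) sx sy !andbT /=.
  by apply/allP => c; rewrite (perm_mem pw) => /(mem_subseq sxy).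
case/and4P=> wU /allP wxy sx sy; apply/and3P; split=> //.
apply/and3P; split; [|by rewrite restrict_restrict..].
apply: uniq_perm => //; first exact: (subseq_uniq (cat_subseq sx sy)).
move=> c; rewrite mem_cat !mem_restrict -andb_orl -mem_cat.
by case cw: (c \in w); rewrite ?andbF // andbT; have /= -> := wxy c cw.
Qed.

Lemma in_shufflesP x y w : uniq (x ++ y) ->
  reflect (exists u v, [/\ subseq u x, subseq v y & is_shuffle u v w])
          (in_shuffles x y w).
Proof.
move=> xyU; apply: (iffP idP) => [/and3P[sx sy sh]|].
  by exists (restrict w x), (restrict w y).
case=> u [v] [sx sy] /and3P[pw /eqP wu /eqP wv].
have sxy := cat_subseq sx sy.
have /and3P[_ /hasPn xNy _] : [&& uniq x, ~~ has [in x] y & uniq y].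
  by rewrite -cat_uniq.
have ex : restrict w x = u.
  rewrite -[RHS]wu; apply: eq_in_filter => c; rewrite (perm_mem pw) mem_cat.
  case/orP=> [cu|cv]; first by rewrite cu (mem_subseq sx).
  have cy := mem_subseq sy cv; rewrite (negPf (xNy _ cy)).
  by apply/esym/negbTE; apply: contra (xNy _ cy) => /(mem_subseq sx).
have ey : restrict w y = v.
  rewrite -[RHS]wv; apply: eq_in_filter => c; rewrite (perm_mem pw) mem_cat.
  case/orP=> [cu|cv]; last by rewrite cv (mem_subseq sy).
  have cx := mem_subseq sx cu; transitivity false.
    by apply/negbTE/negP => /xNy; rewrite /= cx.
  by apply/esym/negbTE/negP => /(mem_subseq sy) /xNy; rewrite /= cx.
apply/and3P; split; rewrite ?ex ?ey //.
by apply/and3P; split=> //; apply/eqP.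
Qed.

(* [subseq [:: p; q] w]: the letter [p] occurs before [q] in [w]. *)

Lemma subseq2_mem p q w : subseq [:: p; q] w -> p \in w /\ q \in w.
Proof. by move/mem_subseq=> s; split; apply: s; rewrite !inE eqxx ?orbT. Qed.

Lemma index_eq s p q : p \in s -> q \in s -> index p s = index q s -> p = q.
Proof. exact: (index_inj p). Qed.

Lemma subseq2_index p q w : uniq w -> p \in w -> q \in w ->
  subseq [:: p; q] w = (index p w < index q w).
Proof.
elim: w => // c w IH /andP[cw wU]; rewrite !inE.
have [->|pc] := eqVneq p c; have [->|qc] := eqVneq q c => /=.
- by rewrite eqxx ltnn sub1seq (negPf cw).
- by rewrite eqxx eq_sym (negPf qc) sub1seq => _ ->.
- move=> pw _; rewrite (negPf pc) eqxx ltn0; apply/negbTE.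
  by apply: contra cw => /subseq2_mem[].
- move=> pw qw; rewrite (negPf pc) eq_sym (negPf pc) eq_sym (negPf qc) ltnS.
  exact: IH.
Qed.

Lemma pairwise_subseq2 (r : rel T) w :
  (forall p q, subseq [:: p; q] w -> r p q) -> pairwise r w.
Proof.
elim: w => // c w IH rw; rewrite pairwise_cons; apply/andP; split.
  by apply/allP => q qw; apply: rw; rewrite /= eqxx sub1seq.
apply: IH => p q pq; apply: rw.
by apply: (subseq_trans pq); apply: subseq_cons.
Qed.

Lemma subseq2_restrict p q u v :
  subseq [:: p; q] (restrict u v) = [&& p \in v, q \in v & subseq [:: p; q] u].
Proof. by rewrite subseq_filter /= andbT andbA. Qed.

Section Order.
Variables x y : seq T.
Hypothesis xyU : uniq (x ++ y).

Let xU : uniq x. Proof. by move: xyU; rewrite cat_uniq => /and3P[]. Qed.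
Let yU : uniq y. Proof. by move: xyU; rewrite cat_uniq => /and3P[]. Qed.
Let xNy c : c \in x -> (c \in y) = false.
Proof.
move=> cx; apply/negbTE/negP => cy; move: xyU.
by rewrite cat_uniq => /and3P[_ /hasPn/(_ _ cy)]; rewrite /= cx.
Qed.
Let yNx c : c \in y -> (c \in x) = false.
Proof. by move=> cy; apply/negbTE/negP => /xNy; rewrite cy. Qed.

Lemma in_shuffles_x : in_shuffles x y x.
Proof.
rewrite in_shufflesE // xU !filter_subseq /=; apply/andP; split.
  by apply/allP => c /=; rewrite mem_cat => ->.
by rewrite /restrict (eq_in_filter xNy) filter_pred0 sub0seq.
Qed.

Lemma in_shuffles_y : in_shuffles x y y.
Proof.
rewrite in_shufflesE // yU !filter_subseq andbT /=; apply/andP; split.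
  by apply/allP => c /=; rewrite mem_cat => ->; rewrite orbT.
by rewrite /restrict (eq_in_filter yNx) filter_pred0 sub0seq.
Qed.

Lemma in_shuffles_uniq w : in_shuffles x y w -> uniq w.
Proof. by rewrite in_shufflesE // => /and4P[]. Qed.

Lemma in_shuffles_mem w c : in_shuffles x y w -> c \in w ->
  (c \in x) || (c \in y).
Proof.
by rewrite in_shufflesE // => /and4P[_ /allP wxy _ _] /wxy /=; rewrite mem_cat.
Qed.

Lemma shuffle_leP v w :
  reflect [/\ {subset restrict w x <= restrict v x},
              {subset restrict v y <= restrict w y}
            & restrict v w = restrict w v]
          (shuffle_le x y v w).
Proof.
apply: (iffP and3P) => [[/allP h1 /allP h2 /eqP h3]|[h1 h2 h3]].
  by split=> //.
by split; [apply/allP | apply/allP | apply/eqP].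
Qed.

Lemma shuffle_le_refl w : shuffle_le x y w w.
Proof. by apply/shuffle_leP; split. Qed.

Lemma shuffle_le_anti v w : in_shuffles x y v -> in_shuffles x y w ->
  shuffle_le x y v w -> shuffle_le x y w v -> v = w.
Proof.
move=> vW wW /shuffle_leP[xwv yvw vw] /shuffle_leP[xvw ywv _].
have sub u u' : in_shuffles x y u -> {subset restrict u x <= restrict u' x} ->
    {subset restrict u y <= restrict u' y} -> restrict u u' = u.
  move=> uW ux uy; apply/all_filterP/allP => c cu /=.
  have /orP[cx|cy] := in_shuffles_mem uW cu.
    by have := ux c; rewrite !mem_restrict cx cu => /(_ isT).
  by have := uy c; rewrite !mem_restrict cy cu => /(_ isT).
by rewrite -(sub v w) // vw sub.
Qed.

Lemma shuffle_le_trans w v z : in_shuffles x y v -> in_shuffles x y z ->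
  shuffle_le x y v w -> shuffle_le x y w z -> shuffle_le x y v z.
Proof.
move=> vW zW /shuffle_leP[xwv yvw vw] /shuffle_leP[xzw ywz wz].
apply/shuffle_leP; split=> [c /xzw/xwv //|c /yvw/ywz //|].
have mw c : c \in v -> c \in z -> c \in w.
  move=> cv cz; have /orP[cx|cy] := in_shuffles_mem vW cv.
    by have := xzw c; rewrite !mem_restrict cx cz => /(_ isT).
  by have := yvw c; rewrite !mem_restrict cy cv => /(_ isT).
have restrictC s t u : restrict (restrict s t) u = restrict (restrict s u) t.
  by rewrite /restrict -!filter_predI; apply: eq_filter => c /=; rewrite andbC.
have -> : restrict v z = restrict (restrict v w) z.
  rewrite /restrict -filter_predI; apply: eq_in_filter => c cv /=.
  by case cz: (c \in z) => //=; rewrite mw.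
rewrite vw restrictC wz restrictC /restrict -filter_predI.
apply: eq_in_filter => c cz /=.
by case cv: (c \in v); rewrite /= ?andbF // mw.
Qed.

Lemma eq_subseq2 s t : uniq s -> uniq t -> s =i t ->
  (forall p q, subseq [:: p; q] s -> subseq [:: p; q] t) -> s = t.
Proof.
move=> sU tU st H; pose r p q := index p t < index q t.
have rtr : transitive r by move=> ? ? ?; apply: ltn_trans.
have rirr : irreflexive r by move=> ?; apply: ltnn.
apply: (irr_sorted_eq rtr rirr) => //; rewrite sorted_pairwise //.
  apply: pairwise_subseq2 => p q /[dup] /subseq2_mem[ps qs] /H.
  by rewrite subseq2_index // -st.
apply: pairwise_subseq2 => p q /[dup] /subseq2_mem[ps qs].
by rewrite subseq2_index.
Qed.

Lemma subseq_subseq2 s t : uniq s -> uniq t -> {subset s <= t} ->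
  (forall p q, subseq [:: p; q] s -> subseq [:: p; q] t) -> subseq s t.
Proof.
move=> sU tU st H; suff -> : s = restrict t s by apply: filter_subseq.
apply: eq_subseq2 => // [|c|p q pq]; first exact: filter_uniq.
  by rewrite mem_restrict; case cs: (c \in s) => //=; rewrite st.
by have [ps qs] := subseq2_mem pq; rewrite subseq2_restrict ps qs H.
Qed.

(* Two words of the poset always agree on the order of letters of the same kind,
   so only the relative order of the letters of [x] and [y] matters. *)
Lemma shuffle_le_criterion v w : in_shuffles x y v -> in_shuffles x y w ->
  (forall a, a \in x -> a \in w -> a \in v) ->
  (forall b, b \in y -> b \in v -> b \in w) ->
  (forall a b, a \in x -> b \in y -> a \in v -> a \in w -> b \in v ->
    b \in w -> subseq [:: a; b] v -> subseq [:: a; b] w) ->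
  (forall a b, a \in x -> b \in y -> a \in v -> a \in w -> b \in v ->
    b \in w -> subseq [:: b; a] v -> subseq [:: b; a] w) ->
  shuffle_le x y v w.
Proof.
move=> vW wW wx vy xy yx; have vU := in_shuffles_uniq vW.
have wU := in_shuffles_uniq wW; apply/shuffle_leP; split.
- by move=> c; rewrite !mem_restrict => /andP[cx cw]; rewrite cx wx.
- by move=> c; rewrite !mem_restrict => /andP[cy cv]; rewrite cy vy.
have same z p q : z = x \/ z = y -> p \in z -> q \in z -> p \in w -> q \in w ->
    subseq [:: p; q] v -> subseq [:: p; q] w.
  move=> zxy pz qz pw qw pq; have [pv qv] := subseq2_mem pq.
  have [zU sv sw] : [/\ uniq z, subseq (restrict v z) z & subseq (restrict w z) z].
    by case/and3P: vW wW => ? ? _ /and3P[? ? _]; case: zxy => ->.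
  have pvz : subseq [:: p; q] z.
    by apply: subseq_trans sv; rewrite subseq2_restrict pz qz.
  case: (ltngtP (index p w) (index q w)) => [lt|lt|eq].
  - by rewrite subseq2_index.
  - have : subseq [:: q; p] z.
      by apply: subseq_trans sw; rewrite subseq2_restrict pz qz subseq2_index.
    move: pvz; rewrite !subseq2_index // => lt1 lt2.
    by have := ltn_trans lt1 lt2; rewrite ltnn.
  - move: pvz; rewrite subseq2_index // (index_eq pw qw eq) ltnn //.
apply: eq_subseq2; try exact: filter_uniq.
  by move=> c; rewrite !mem_restrict andbC.
move=> p q; rewrite !subseq2_restrict => /and3P[pw qw pq].
have [pv qv] := subseq2_mem pq; rewrite pv qv /=.
have /orP[px|py] := in_shuffles_mem vW pv;
have /orP[qx|qy] := in_shuffles_mem vW qv.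
- by apply: (same x) => //; left.
- exact: xy.
- exact: yx.
- by apply: (same y) => //; right.
Qed.

Lemma shuffle_le0x w : in_shuffles x y w -> shuffle_le x y x w.
Proof.
move=> wW; have nb b : b \in y -> b \in x -> False by move=> /yNx ->.
apply: shuffle_le_criterion => //; first exact: in_shuffles_x.
- by move=> b by_ /nb; case.
- by move=> a b _ /nb nbx _ _ /nbx.
- by move=> a b _ /nb nbx _ _ /nbx.
Qed.

Lemma shuffle_lex1 w : in_shuffles x y w -> shuffle_le x y w y.
Proof.
move=> wW; have na a : a \in x -> a \in y -> False by move=> /xNy ->.
apply: shuffle_le_criterion => //; first exact: in_shuffles_y.
- by move=> a /na nay /nay.
- by move=> a b /na nay _ _ /nay.
- by move=> a b /na nay _ _ /nay.
Qed.

Section Join.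
Variables v w : seq T.
Hypotheses (vW : in_shuffles x y v) (wW : in_shuffles x y w).

Let before p q := subseq [:: p; q] v || subseq [:: p; q] w.

(* [cut a] is the length of the shortest prefix of [y] containing all letters of
   [y] which precede [a] in [v] or in [w]. *)
Definition cut a := \max_(b <- y | before b a) (index b y).+1.

Definition join_letters :=
  [seq a <- x | [&& a \in v, a \in w
     & all (fun b => before a b ==> (cut a <= index b y)) y]]
  ++ [seq b <- y | (b \in v) || (b \in w)].

Definition key c := if c \in x then cut c * (size x).+1 + index c x
                    else index c y * (size x).+1 + size x.

Definition shuffle_join := sort (relpre key leq) join_letters.

Let J := shuffle_join.

Lemma mem_join c : (c \in J) = (c \in join_letters).
Proof. by rewrite mem_sort. Qed.

Lemma mem_join_x a : a \in x -> (a \in J) =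
  [&& a \in v, a \in w & all (fun b => before a b ==> (cut a <= index b y)) y].
Proof. by move=> ax; rewrite mem_join mem_cat !mem_filter ax xNy // andbF orbF andbT. Qed.

Lemma mem_join_y b : b \in y -> (b \in J) = (b \in v) || (b \in w).
Proof. by move=> bY; rewrite mem_join mem_cat !mem_filter bY yNx // andbF andbT. Qed.

Lemma join_mem c : c \in J -> (c \in x) || (c \in y).
Proof.
by rewrite mem_join mem_cat !mem_filter => /orP[]/andP[_ ->]; rewrite ?orbT.
Qed.

Lemma join_uniq : uniq J.
Proof.
rewrite sort_uniq; apply: subseq_uniq xyU.
by apply: cat_subseq; apply: filter_subseq.
Qed.

Lemma key_xy a b : a \in x -> b \in y -> (key a < key b) = (cut a <= index b y).
Proof.
move=> ax bY; rewrite /key ax yNx //.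
have: index a x < size x by rewrite index_mem.
move: (cut a) (index b y) (index a x) (size x) => k j i m im.
case: (leqP k j) => kj.
  by rewrite -addnS leq_add // leq_mul2r kj orbT.
apply/negbTE; rewrite -leqNgt.
have : j.+1 * m.+1 <= k * m.+1 by rewrite leq_mul2r kj orbT.
rewrite mulSn => h; apply: leq_trans (leq_addr _ _); apply: leq_trans h.
by rewrite addnC leq_add2r.
Qed.

Lemma key_neq a b : a \in x -> b \in y -> key a != key b.
Proof.
move=> ax bY; rewrite /key ax yNx //; apply/negP => /eqP /(congr1 (modn^~ (size x).+1)).
have im : index a x < size x by rewrite index_mem.
rewrite !modnMDl !modn_small ?(ltnW im) // => [e|]; last exact: ltnW.
by rewrite e ltnn in im.
Qed.

Lemma key_yy b b' : b \in y -> b' \in y -> (key b < key b') = (index b y < index b' y).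
Proof. by move=> bY b'Y; rewrite /key !yNx // ltn_add2r ltn_mul2r. Qed.

Lemma key_inj p q : p \in J -> q \in J -> key p = key q -> p = q.
Proof.
move=> /join_mem/orP[px|py] /join_mem/orP[qx|qy] e.
- move: e; rewrite /key px qx => /(congr1 (modn^~ (size x).+1)).
  rewrite !modnMDl !modn_small ?ltnS ?index_size // => e.
  exact: index_eq px qx e.
- by have := key_neq px qy; rewrite e eqxx.
- by have := key_neq qx py; rewrite e eqxx.
- apply: (index_eq py qy); apply/eqP; rewrite eqn_leq.
  by rewrite [in X in X && _]leqNgt -key_yy // e ltnn leqNgt -key_yy // e ltnn.
Qed.

Lemma subseq2_join p q : p \in J -> q \in J ->
  subseq [:: p; q] J = (key p < key q).
Proof.
move=> pJ qJ.
have tr : transitive (relpre key leq) by move=> ? ? ?; apply: leq_trans.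
have ssJ : sorted (relpre key leq) J by apply: sort_sorted => ? ?; apply: leq_total.
have imp a b : a \in J -> b \in J -> subseq [:: a; b] J -> key a < key b.
  move=> aJ bJ; rewrite subseq2_index ?join_uniq // => ab.
  have /= le := sorted_ltn_index tr ssJ a b aJ bJ ab; rewrite ltn_neqAle {}le andbT.
  by apply: contraTneq ab => /(key_inj aJ bJ) ->; rewrite ltnn.
apply/idP/idP; first exact: imp.
move=> lt; rewrite subseq2_index ?join_uniq // ltnNge; apply/negP.
rewrite leq_eqVlt => /orP[/eqP/(index_eq qJ pJ) e|]; first by rewrite e ltnn in lt.
rewrite -subseq2_index ?join_uniq // => /(imp _ _ qJ pJ) /(ltn_trans lt).
by rewrite ltnn.
Qed.

Lemma cut_le a j :
  (forall b, b \in y -> before b a -> index b y < j) -> cut a <= j.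
Proof.
move=> H; rewrite /cut big_seq_cond.
by apply/bigmax_leqP_seq => b _ /andP[bY]; apply: H.
Qed.

Lemma lt_cut a b : b \in y -> before b a -> index b y < cut a.
Proof. by move=> bY ba; apply: (@leq_bigmax_seq _ y (before^~ a) (fun b => (index b y).+1)). Qed.

Lemma restrict_before z u p q : in_shuffles x y u -> z = x \/ z = y ->
  p \in z -> q \in z -> p \in u -> q \in u ->
  subseq [:: p; q] u = (index p z < index q z).
Proof.
move=> uW zxy pz qz pu qu.
have [zU su] : uniq z /\ subseq (restrict u z) z.
  by case/and3P: uW => ? ? _; case: zxy => ->.
have imp a b : a \in z -> b \in z -> subseq [:: a; b] u -> index a z < index b z.
  move=> az bz ab; rewrite -subseq2_index //; apply: subseq_trans su.
  by rewrite subseq2_restrict az bz.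
apply/idP/idP; first exact: imp.
have uU := in_shuffles_uniq uW.
move=> lt; rewrite subseq2_index // ltnNge; apply/negP.
rewrite leq_eqVlt => /orP[/eqP/(index_eq qu pu) e|]; first by rewrite e ltnn in lt.
rewrite -subseq2_index // => /(imp _ _ qz pz) /(ltn_trans lt).
by rewrite ltnn.
Qed.

Lemma subseq2_trans u p q r : uniq u -> subseq [:: p; q] u ->
  subseq [:: q; r] u -> subseq [:: p; r] u.
Proof.
move=> uU /[dup]/subseq2_mem[pu qu] + /[dup]/subseq2_mem[_ ru].
by rewrite !subseq2_index //; apply: ltn_trans.
Qed.

Lemma key_xx a a' : a \in x -> a' \in x -> a \in J -> a' \in J ->
  key a < key a' -> index a x < index a' x.
Proof.
move=> ax a'x; rewrite !mem_join_x // => /and3P[av aw _] /and3P[a'v a'w _] lt.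
rewrite ltnNge; apply/negP; rewrite leq_eqVlt => /orP[/eqP|] h.
  by move: lt; rewrite (index_eq a'x ax h) ltnn.
move: lt; apply/negP; rewrite -leqNgt /key ax a'x leq_add ?(ltnW h) //.
rewrite leq_mul2r /=; apply: cut_le => b bY ba'; apply: lt_cut => //.
case/orP: ba' => [bv|bw]; apply/orP; [left|right].
  apply: subseq2_trans bv _; first exact: in_shuffles_uniq.
  by rewrite (restrict_before vW (or_introl erefl)).
apply: subseq2_trans bw _; first exact: in_shuffles_uniq.
by rewrite (restrict_before wW (or_introl erefl)).
Qed.

Lemma in_shuffles_join : in_shuffles x y J.
Proof.
rewrite in_shufflesE // join_uniq /=; apply/and3P; split.
- by apply/allP => c /join_mem /=; rewrite mem_cat.
- apply: subseq_subseq2 => //; first by rewrite filter_uniq // join_uniq.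
    by move=> c; rewrite mem_restrict => /andP[].
  move=> p q; rewrite subseq2_restrict => /and3P[px qx /[dup]/subseq2_mem[pJ qJ]].
  by rewrite subseq2_join // subseq2_index //; apply: key_xx.
- apply: subseq_subseq2 => //; first by rewrite filter_uniq // join_uniq.
    by move=> c; rewrite mem_restrict => /andP[].
  move=> p q; rewrite subseq2_restrict => /and3P[px qx /[dup]/subseq2_mem[pJ qJ]].
  by rewrite subseq2_join // subseq2_index // key_yy.
Qed.

Lemma shuffle_le_join u : in_shuffles x y u -> u = v \/ u = w ->
  shuffle_le x y u J.
Proof.
move=> uW uvw; have bu p q : subseq [:: p; q] u -> before p q.
  by rewrite /before; case: uvw => <- ->; rewrite ?orbT.
apply: shuffle_le_criterion => //; first exact: in_shuffles_join.
- by move=> a ax; rewrite mem_join_x // => /and3P[? ? _]; case: uvw => ->.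
- by move=> b bY; rewrite mem_join_y //; case: uvw => -> ->; rewrite ?orbT.
- move=> a b ax bY _ aJ _ bJ /bu ab; rewrite subseq2_join // key_xy //.
  move: aJ; rewrite mem_join_x // => /and3P[_ _ /allP/(_ b bY)].
  by rewrite ab.
- move=> a b ax bY _ aJ _ bJ /bu ba; rewrite subseq2_join //.
  rewrite ltn_neqAle eq_sym key_neq //= leqNgt key_xy // -ltnNge.
  exact: lt_cut.
Qed.

Lemma shuffle_le_same u u' p q : shuffle_le x y u u' -> p \in u' -> q \in u' ->
  subseq [:: p; q] u -> subseq [:: p; q] u'.
Proof.
case/shuffle_leP=> _ _ e pu' qu' pq; have [pu qu] := subseq2_mem pq.
have : subseq [:: p; q] (restrict u u') by rewrite subseq2_restrict pu' qu'.
by rewrite e subseq2_restrict => /and3P[].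
Qed.

Lemma shuffle_join_le u : in_shuffles x y u ->
  shuffle_le x y v u -> shuffle_le x y w u -> shuffle_le x y J u.
Proof.
move=> uW vu wu; have uU := in_shuffles_uniq uW.
have [xv yv _] := shuffle_leP _ _ vu; have [xw yw _] := shuffle_leP _ _ wu.
have uv a : a \in x -> a \in u -> a \in v.
  by move=> ax au; have := xv a; rewrite !mem_restrict ax au => /(_ isT).
have uw a : a \in x -> a \in u -> a \in w.
  by move=> ax au; have := xw a; rewrite !mem_restrict ax au => /(_ isT).
have vwu b : b \in y -> (b \in v) || (b \in w) -> b \in u.
  move=> bY /orP[bv|bw].
    by have := yv b; rewrite !mem_restrict bY bv => /(_ isT).
  by have := yw b; rewrite !mem_restrict bY bw => /(_ isT).
have mem_before p q : before p q -> (p \in v) || (p \in w).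
  by case/orP => /subseq2_mem[-> _]; rewrite ?orbT.
have mem_before' p q : before p q -> (q \in v) || (q \in w).
  by case/orP => /subseq2_mem[_ ->]; rewrite ?orbT.
have bu p q : before p q -> p \in u -> q \in u -> subseq [:: p; q] u.
  by case/orP=> pq pu qu; [apply: shuffle_le_same vu _ _ _
                          |apply: shuffle_le_same wu _ _ _].
have cutE a b : a \in x -> b \in y -> a \in u -> b \in u ->
    subseq [:: a; b] u -> cut a <= index b y.
  move=> ax bY au bU ab; apply: cut_le => b' b'Y b'a.
  have b'u : b' \in u by apply: vwu => //; apply: mem_before b'a.
  rewrite -(restrict_before uW (or_intror erefl)) //.
  by apply: subseq2_trans ab => //; apply: bu.
have uJ a : a \in x -> a \in u -> a \in J.
  move=> ax au; rewrite mem_join_x // uv // uw //=.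
  apply/allP => b bY; apply/implyP => ab.
  have bU : b \in u by apply: vwu => //; apply: mem_before' ab.
  by apply: cutE => //; apply: bu.
apply: shuffle_le_criterion => //; first exact: in_shuffles_join.
- by move=> b bY; rewrite mem_join_y //; apply: vwu.
- move=> a b ax bY aJ au bJ bU; rewrite subseq2_join // key_xy // => le.
  have bvw : (b \in v) || (b \in w) by rewrite -mem_join_y.
  have: (a \in v) && (a \in w) by rewrite uv ?uw.
  case/andP=> av aw; rewrite subseq2_index // ltnNge; apply/negP => ba.
  have /negP[] : ~~ before b a.
    by apply/negP => /(lt_cut bY); rewrite ltnNge le.
  have ltba : ~~ subseq [:: a; b] u by rewrite subseq2_index // -leqNgt.
  have neq : a != b by apply: contraTneq bY => <-; rewrite xNy.
  have tri u' : uniq u' -> a \in u' -> b \in u' ->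
      ~~ subseq [:: a; b] u' -> subseq [:: b; a] u'.
    move=> u'U au' bu'; rewrite !subseq2_index // -leqNgt leq_eqVlt.
    by case/orP=> // /eqP/(index_eq bu' au') e; rewrite e eqxx in neq.
  case/orP: bvw => [bv|bw]; apply/orP; [left|right].
    apply: tri => //; first exact: in_shuffles_uniq vW.
    by apply: contra ltba => ab; apply: shuffle_le_same vu _ _ ab.
  apply: tri => //; first exact: in_shuffles_uniq wW.
  by apply: contra ltba => ab; apply: shuffle_le_same wu _ _ ab.
- move=> a b ax bY aJ au bJ bU; rewrite subseq2_join // => lt.
  rewrite subseq2_index // ltnNge; apply/negP; rewrite leq_eqVlt.
  case/orP=> [/eqP/(index_eq au bU) e|]; first by rewrite -e xNy in bY.
  rewrite -subseq2_index // => /cutE le; move: lt.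
  by apply/negP; rewrite -leqNgt ltnW // key_xy // le.
Qed.

End Join.
End Order.
End Words.

Fact shuffles_display : Order.disp_t. Proof. exact: Order.Disp tt tt. Qed.

(* The parameter [xyU] is only there so that the order-theoretic instances,
   which rely on it, can be inferred from the type. *)
Record shuffles (T : eqType) (x y : seq T) (xyU : uniq (x ++ y)) := Shuffle {
  word :> seq T;
  _ : in_shuffles x y word }.

Section Shuffles.
Variables (T : eqType) (x y : seq T) (xyU : uniq (x ++ y)).

Local Notation W := (shuffles xyU).

HB.instance Definition _ := [isSub for @word T x y xyU].
HB.instance Definition _ := [Equality of W by <:].

Lemma shufflesP (w : W) : in_shuffles x y w. Proof. exact: valP. Qed.

Definition shuffles_enum : seq W :=
  undup (pmap insub
    (flatten [seq permutations (mask (m : bitseq) (x ++ y))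
             | m : (size (x ++ y)).-tuple bool])).

Lemma mem_shuffles_enum w : w \in shuffles_enum.
Proof.
rewrite mem_undup mem_pmap_sub /=.
have := shufflesP w; rewrite in_shufflesE // => /and4P[wU /allP wxy _ _].
apply/flattenP; exists (permutations [seq c <- x ++ y | c \in val w]).
  have szm : size [seq c \in val w | c <- x ++ y] == size (x ++ y).
    by rewrite size_map.
  by rewrite filter_mask; apply/mapP; exists (Tuple szm); rewrite ?mem_enum.
rewrite mem_permutations; apply: uniq_perm => //; first exact: filter_uniq.
by move=> c; rewrite mem_filter; case cw: (c \in val w) => //; rewrite [RHS]wxy.
Qed.

Lemma shuffles_pickleK :
  pcancel (index^~ shuffles_enum) (onth shuffles_enum).
Proof.
move=> w; rewrite onthE (nth_map w) ?index_mem ?mem_shuffles_enum //.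
by rewrite nth_index // mem_shuffles_enum.
Qed.

HB.instance Definition _ : isCountable W := PCanIsCountable shuffles_pickleK.

Lemma shuffles_enumP : Finite.axiom shuffles_enum.
Proof. by move=> w; rewrite count_uniq_mem ?undup_uniq // mem_shuffles_enum. Qed.

HB.instance Definition _ := isFinite.Build W shuffles_enumP.

Definition wle (v w : W) := shuffle_le x y v w.

Lemma wle_refl : reflexive wle. Proof. by move=> w; apply: shuffle_le_refl. Qed.

Lemma wle_anti : antisymmetric wle.
Proof.
move=> v w /andP[vw wv]; apply: val_inj.
exact: (shuffle_le_anti xyU (shufflesP v) (shufflesP w)).
Qed.

Lemma wle_trans : transitive wle.
Proof. by move=> w v z; apply: (shuffle_le_trans xyU); apply: shufflesP. Qed.

HB.instance Definition _ :=
  Order.Le_isPOrder.Build shuffles_display W wle_refl wle_anti wle_trans.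

Definition word_x : W := Shuffle xyU (in_shuffles_x xyU).
Definition word_y : W := Shuffle xyU (in_shuffles_y xyU).

Lemma wle0x w : wle word_x w. Proof. exact: (shuffle_le0x xyU (shufflesP w)). Qed.
Lemma wlex1 w : wle w word_y. Proof. exact: (shuffle_lex1 xyU (shufflesP w)). Qed.

HB.instance Definition _ := Order.hasBottom.Build shuffles_display W wle0x.
HB.instance Definition _ := Order.hasTop.Build shuffles_display W wlex1.

Definition wjoin (v w : W) : W :=
  Shuffle xyU (in_shuffles_join xyU (shufflesP v) (shufflesP w)).

Lemma wjoinP v w z : wle (wjoin v w) z = wle v z && wle w z.
Proof.
have [vW wW] := (shufflesP v, shufflesP w); have zW := shufflesP z.
apply/idP/andP => [le|[vz wz]]; last exact: (shuffle_join_le xyU).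
split; apply: wle_trans le; apply: (shuffle_le_join xyU) => //; by [left|right].
Qed.

Definition wmeet (v w : W) : W :=
  foldr wjoin word_x [seq u <- enum {: W} | wle u v && wle u w].

Lemma wmeetP z v w : wle z (wmeet v w) = wle z v && wle z w.
Proof.
have foldrP s u : wle (foldr wjoin word_x s) u = all (wle^~ u) s.
  by elim: s => /= [|t s IH]; rewrite ?wle0x // wjoinP IH.
apply/idP/idP => [le|zvw].
  by apply/andP; split; apply: (wle_trans le); rewrite foldrP;
     apply/allP => u; rewrite mem_filter => /andP[/andP[]].
have := wle_refl (wmeet v w); rewrite {1}/wmeet foldrP => /allP; apply.
by rewrite mem_filter zvw mem_enum.
Qed.

HB.instance Definition _ :=
  Order.POrder_MeetJoin_isLattice.Build shuffles_display W wmeetP wjoinP.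

End Shuffles.

Section Atoms.
Local Open Scope order_scope.
Variables (T : eqType) (x y : seq T) (xyU : uniq (x ++ y)).
Local Notation W := (shuffles xyU).

Definition a_atoms : {set W} :=
  [set a in atoms | has (fun c => word a == rem c x) x].

Definition b_atoms : {set W} :=
  [set b in atoms |
    has (fun c => [exists i : 'I_(size x).+1, word b == insert_at i c x]) y].

Definition atom_le (a d : W) : bool :=
  (a == d) || ((a \in a_atoms) && (d \in b_atoms)).

Definition B_ (s : W) : {set W} := a_atoms :|: [set b in b_atoms | b <= s].

Lemma a_atomsNb a : a \in a_atoms -> a \notin b_atoms.
Proof.
rewrite !inE => /andP[_ /hasP[c cx /eqP ac]]; apply/negP.
case/andP=> _ /hasP[d _ /existsP[i /eqP ad]].
have := congr1 size ac; rewrite ad size_rem // size_cat /= addnS -size_cat.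
by rewrite cat_take_drop => e; have := leq_pred (size x); rewrite -e ltnn.
Qed.

Lemma atom_le_lt a d :
  (a != d) && atom_le a d = (a \in a_atoms) && (d \in b_atoms).
Proof.
rewrite /atom_le; case: eqVneq => //= <-.
by case aA: (a \in a_atoms) => //=; rewrite (negPf (a_atomsNb aA)).
Qed.

Lemma atom_le_refl : reflexive atom_le.
Proof. by move=> a; rewrite /atom_le eqxx. Qed.

Lemma atom_le_anti : antisymmetric atom_le.
Proof.
move=> a d /andP[/orP[/eqP//|/andP[aA _]] /orP[/eqP//|/andP[_ aB]]].
by have := a_atomsNb aA; rewrite aB.
Qed.

Lemma atom_le_trans : transitive atom_le.
Proof.
move=> d a e /orP[/eqP->//|/andP[aA dB]] /orP[/eqP<-|/andP[dA _]].
  by rewrite /atom_le aA dB orbT.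
by have := a_atomsNb dA; rewrite dB.
Qed.

End Atoms.

(* Main.v *)
Require Import Defs.
From mathcomp Require Import all_boot all_order.

(** Everything is reduced to letters. Deleting letters from a word of the poset
    stays in the poset ([wfilter]) and interacts simply with the order
    ([wfilter_le], [le_wfilter]); this yields all the upper and lower bounds
    that the proof needs, so that joins never have to be computed.

    The a-atom deleting [c] lies below [w] iff [c] does not occur in [w]
    ([del_le]), and a b-atom inserting [c] is determined by any word above it
    that contains all of [x] ([inserts_le]). Since [atom_le] puts every
    a-atom below every b-atom, a set is bounded below iff it is a nonempty set
    of b-atoms whose join misses a letter of [x]. Hence a set [B] of atoms is
    NBB iff the join [s] of its b-atoms contains every letter of [x]
    ([nbbP]).

    Let [B] be an NBB base of [y]. Removing from [s] the letters deleted by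
    the a-atoms of [B] gives an upper bound of [B], that is [y]; so [s] contains
    all of [y], making it a shuffle of [x] and [y], and every letter of [x] is
    deleted by some a-atom of [B]. Moreover a letter of [y] can occur in [s]
    only if a b-atom of [B] inserts it, and [s] leaves a single place for that
    insertion; hence [B] contains each b-atom below [s], and [B] is [B_ s].

    Conversely, the b-atoms of [B_ s] have a join below [s], which therefore
    keeps every letter of [x]; and the join of [B_ s] loses all of [x] to the
    a-atoms and has all of [y], because [s] restricted to [x] and one letter of
    [y] is a b-atom below [s]. *)

Set Implicit Arguments.
Unset Strict Implicit.
Unset Printing Implicit Defensive.

Import Order.TTheory.

Section NBBBases.
Local Open Scope order_scope.
Variables (T : eqType) (x y : seq T) (xyU : uniq (x ++ y)).
Local Notation W := (shuffles xyU).
Implicit Types (u v w s a b d : W) (c : T) (P : pred T) (B : {set W}).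

(** * Letters and the order *)

Lemma xNy c : c \in x -> c \in y -> False.
Proof.
move=> cx cy; move: xyU; rewrite cat_uniq => /and3P[_ /hasPn/(_ _ cy)].
by rewrite /= cx.
Qed.

Lemma word_uniq w : uniq (word w).
Proof. exact: in_shuffles_uniq xyU _ (shufflesP w). Qed.

Lemma word_mem w c : c \in word w -> (c \in x) || (c \in y).
Proof. exact: in_shuffles_mem xyU _ _ (shufflesP w). Qed.

Lemma leWP v w :
  reflect [/\ forall c, c \in x -> c \in word w -> c \in word v,
              forall c, c \in y -> c \in word v -> c \in word w
            & restrict (word v) (word w) = restrict (word w) (word v)]
          (v <= w).
Proof.
apply: (iffP (shuffle_leP x y v w)) => -[hx hy e]; split=> // c.
- by move=> cx cw; have := hx c; rewrite !mem_restrict cx cw => /(_ isT).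
- by move=> cy cv; have := hy c; rewrite !mem_restrict cy cv => /(_ isT).
- by rewrite !mem_restrict => /andP[cx cw]; rewrite cx hx.
- by rewrite !mem_restrict => /andP[cy cv]; rewrite cy hy.
Qed.

Lemma le_memx v w c : v <= w -> c \in x -> c \in word w -> c \in word v.
Proof. by case/leWP=> + _ _; apply. Qed.

Lemma le_memy v w c : v <= w -> c \in y -> c \in word v -> c \in word w.
Proof. by case/leWP=> _ + _; apply. Qed.

(** The order only lets two words differ by their letters, so a word all of
    whose letters survive in [w] can be read off from [w]. *)
Lemma le_determined v w : v <= w -> {subset word v <= word w} ->
  word v = restrict (word w) (word v).
Proof. by case/leWP=> _ _ <- vw; apply/esym/all_filterP/allP. Qed.

Lemma x_determined w : {subset x <= word w} -> x = restrict (word w) x.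
Proof. exact: (@le_determined \bot w (le0x w)). Qed.

Lemma in_shuffles_filter P w : in_shuffles x y (filter P (word w)).
Proof.
have := shufflesP w; rewrite !in_shufflesE // => /and4P[wU /allP wxy sx sy].
have fr z : subseq (restrict (filter P (word w)) z) (restrict (word w) z).
  by rewrite /restrict -filter_predI (eq_filter (fun c => andbC _ _))
             filter_predI filter_subseq.
rewrite filter_uniq // !(subseq_trans (fr _)) //= andbT.
by apply/allP => c; rewrite mem_filter => /andP[_ /wxy].
Qed.

Definition wfilter P w : W := Shuffle xyU (in_shuffles_filter P w).

Lemma mem_wfilter P w c : (c \in word (wfilter P w)) = P c && (c \in word w).
Proof. exact: mem_filter. Qed.

(** Deleting letters of [y] lowers a word and deleting letters of [x] raises
    it. Hence deleting letters from [v] keeps it below [w] as long as the letters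
    of [x] that [w] requires remain; [le_wfilter] is the dual fact. *)
Lemma wfilter_le P v w : v <= w ->
  (forall c, c \in x -> c \in word w -> P c) -> wfilter P v <= w.
Proof.
case/leWP=> hx hy e Px; apply/leWP; split=> [c cx cw|c cy|].
- by rewrite mem_wfilter Px // hx.
- by rewrite mem_wfilter => /andP[_]; apply: hy.
transitivity (filter P (restrict (word v) (word w))).
  by rewrite /restrict -!filter_predI; apply: eq_filter => c /=; rewrite andbC.
rewrite e /restrict -filter_predI; apply: eq_filter => c /=.
by rewrite mem_filter.
Qed.

Lemma le_wfilter P v w : v <= w ->
  (forall c, c \in y -> c \in word v -> P c) -> v <= wfilter P w.
Proof.
case/leWP=> hx hy e Py; apply/leWP; split=> [c cx|c cy cv|].
- by rewrite mem_wfilter => /andP[_]; apply: hx.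
- by rewrite mem_wfilter Py // hy.
transitivity (filter P (restrict (word w) (word v))).
  rewrite -e /restrict -filter_predI; apply: eq_filter => c /=.
  by rewrite mem_filter.
by rewrite /restrict -!filter_predI; apply: eq_filter => c /=; rewrite andbC.
Qed.

(** * The atoms *)

Definition del c : W := wfilter (predC1 c) \bot.

Lemma mem_del c c' : (c' \in word (del c)) = (c' != c) && (c' \in x).
Proof. exact: mem_wfilter. Qed.

Lemma del_le c w : c \in x -> (del c <= w) = (c \notin word w).
Proof.
move=> cx; apply/idP/idP => [le|cw].
  by apply/negP => /(le_memx le cx); rewrite mem_del eqxx.
by apply: wfilter_le => [|c' _ c'w]; rewrite ?le0x //=; apply: contraNneq cw => <-.
Qed.

Definition inserts c d := word d =i c :: x.

(** A common upper bound containing all letters of [x] and [c] fixes the place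
    at which [c] is inserted. *)
Lemma inserts_le c d d' w : inserts c d -> inserts c d' ->
  {subset c :: x <= word w} -> d <= w -> d' <= w -> d = d'.
Proof.
move=> dE d'E sw dw d'w; apply: val_inj => /=.
rewrite (le_determined dw) => [|e]; last by rewrite dE; apply: sw.
rewrite [RHS](le_determined d'w) => [|e]; last by rewrite d'E; apply: sw.
by apply: eq_filter => e; rewrite dE d'E.
Qed.

(** Over [\bot], that is [x], a word keeping all of [x] has its letters of [x]
    in the original order, so being an insertion is a matter of letters only. *)
Lemma insertsE c d : c \in y ->
  inserts c d <-> exists i : 'I_(size x).+1, word d = insert_at i c x.
Proof.
move=> cy; split=> [dE|[i dE] c']; last first.
  rewrite dE /insert_at mem_cat inE orbCA -mem_cat cat_take_drop.
  by rewrite inE.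
have cd : c \in word d by rewrite dE inE eqxx.
have xd : {subset x <= word d} by move=> c' c'x; rewrite dE inE c'x orbT.
have xE : x = filter (predC1 c) (word d).
  rewrite {1}(x_determined xd); apply: eq_in_filter => c' c'd /=.
  move: c'd; rewrite dE inE; have [-> _|_ /= ->] := eqVneq c' c => //.
  by apply/negbTE/negP => /xNy; apply.
move: (word_uniq d) xE; case/splitPr: cd => p q.
rewrite cat_uniq /= => /and4P[_ /norP[cp _] cq _].
have keep r : c \notin r -> filter (predC1 c) r = r.
  by move=> cr; apply/all_filterP/allP => e er /=; apply: contraNneq cr => <-.
rewrite filter_cat /= eqxx /= !keep // => xE.
have pn : (size p < (size x).+1)%N by rewrite ltnS xE size_cat leq_addr.
by exists (Ordinal pn); rewrite /insert_at /= xE take_size_cat ?drop_size_cat.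
Qed.

(** The explicit candidates for the atoms: they form an antichain, and every
    word other than [x] lies above one of them, so they are the atoms. *)
Definition elementary d :=
  (exists2 c, c \in x & d = del c) \/ (exists2 c, c \in y & inserts c d).

Lemma elementary_neq0 d : elementary d -> d != \bot.
Proof.
move=> dE; apply/eqP => d0; case: dE => -[c cz].
  move=> dE; have: c \in word (\bot : W) by exact: cz.
  by rewrite -d0 dE mem_del eqxx.
by rewrite d0 => /(_ c); rewrite inE eqxx => /= /xNy/(_ cz).
Qed.

Lemma elementary_antichain d d' : elementary d -> elementary d' -> d <= d' ->
  d = d'.
Proof.
case=> -[c cz dE] [] [c' c'z d'E] le.
- move: le; rewrite dE d'E del_le // mem_del cz andbT negbK.
  by move/eqP->.
- by move: le; rewrite dE del_le // d'E inE cz orbT.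
- have := le_memy le cz; rewrite dE inE eqxx d'E mem_del => /(_ isT) /andP[_].
  by move/xNy; case.
have := le_memy le cz; rewrite dE d'E !inE eqxx => /(_ isT) /orP[/eqP ec|]; last first.
  by move/xNy; case.
rewrite -ec in d'E; apply: (inserts_le dE d'E) le (lexx _) => e.
by rewrite d'E.
Qed.

Lemma inserts_wfilter c w : {subset c :: x <= word w} ->
  inserts c (wfilter [in c :: x] w).
Proof. by move=> sw e; rewrite mem_wfilter andb_idr //; apply: sw. Qed.

Lemma wfilter_insert_le c w : wfilter [in c :: x] w <= w.
Proof. by apply: wfilter_le => // e ex _; rewrite inE ex orbT. Qed.

(** A word missing a letter of [x] is above the deletion of that letter; one
    with all of [x], other than [x], has a letter [c] of [y], and keeping only
    [x] and [c] leads to an insertion below it. *)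
Lemma elementary_below w : w != \bot -> exists2 d, elementary d & d <= w.
Proof.
move=> w0; have [/allP xw|] := boolP (all [in word w] x); last first.
  by case/allPn=> c cx cw; exists (del c); [left; exists c|rewrite del_le].
have [/hasP[c cw cy]|/hasPn wy] := boolP (has [in y] (word w)).
  exists (wfilter [in c :: x] w); last exact: wfilter_insert_le.
  right; exists c => //; apply: inserts_wfilter => e.
  by rewrite inE => /orP[/eqP->//|/xw].
case/eqP: w0; apply: val_inj => /=; rewrite [RHS](x_determined xw).
apply/esym/all_filterP/allP => c cw /=.
by have := word_mem cw; rewrite (negPf (wy c cw)) orbF.
Qed.

Lemma atomsP d : reflect (elementary d) (d \in atoms).
Proof.
rewrite inE lt0x; apply: (iffP andP) => [[d0 /forallP min]|dE].
  have [e eE ed] := elementary_below d0.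
  have := min e; rewrite lt0x elementary_neq0 // ed => /eqP <-; exact: eE.
split; first exact: elementary_neq0.
apply/forallP => z; apply/implyP; rewrite lt0x => /andP[z0 zd].
have [e eE ez] := elementary_below z0.
have ed := elementary_antichain eE dE (le_trans ez zd).
by rewrite eq_le zd -ed.
Qed.

Lemma a_atomsP a : reflect (exists2 c, c \in x & a = del c) (a \in a_atoms xyU).
Proof.
have xU : uniq x by move: xyU; rewrite cat_uniq => /and3P[].
rewrite inE; apply: (iffP andP) => [[_ /hasP[c cx /eqP aE]]|[c cx aE]].
  by exists c => //; apply: val_inj; rewrite /= aE rem_filter.
split; first by apply/atomsP; left; exists c.
by apply/hasP; exists c; rewrite // aE rem_filter.
Qed.

Lemma b_atomsP b : reflect (exists2 c, c \in y & inserts c b) (b \in b_atoms xyU).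
Proof.
rewrite inE; apply: (iffP andP) => [[_ /hasP[c cy /existsP[i /eqP bE]]]|[c cy bE]].
  by exists c => //; apply/insertsE => //; exists i.
split; first by apply/atomsP; right; exists c.
apply/hasP; exists c => //; apply/existsP.
by have /(insertsE _ cy)[i bi] := bE; exists i; apply/eqP.
Qed.

Lemma atomsU : atoms = a_atoms xyU :|: b_atoms xyU.
Proof.
apply/setP => d; rewrite in_setU; apply/atomsP/orP => -[] h.
- by left; apply/a_atomsP.
- by right; apply/b_atomsP.
- by left; apply/a_atomsP.
- by right; apply/b_atomsP.
Qed.

(** * NBB sets and bases *)

Definition bjoin B : W := \join_(b in B :&: b_atoms xyU) b.

(** The whole set of b-atoms of [B] is the only subset that has to be tested:
    joins of smaller sets lie lower, hence contain more letters of [x], and an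
    a-atom, which no atom precedes, cannot belong to a bounded below set. *)
Lemma nbbP B : reflect (B \subset atoms /\ {subset x <= word (bjoin B)})
  (nbb (@atom_le _ _ _ xyU) B).
Proof.
apply: (iffP andP) => -[BA H]; split=> //.
  (* If the join misses [c], then [del c] is below it and precedes each b-atom,
     so the b-atoms of [B] are bounded below unless there are none; and then
     their join is [x], which contains [c]. *)
  move=> c cx; apply: contraT => cJ.
  have /implyP/(_ (subsetIl _ _))/negP[] := forallP H (B :&: b_atoms xyU).
  have le : del c <= bjoin B by rewrite del_le.
  apply/and3P; split; last first.
  - apply/forall_inP => d /setIP[dB db]; apply/existsP; exists (del c).
    have da : del c \in a_atoms xyU by apply/a_atomsP; exists c.
    rewrite atomsU in_setU da /= andbA atom_le_lt da db /=.
    rewrite lt_neqAle le andbT; apply: contraTneq da => cE.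
    suff -> : del c = d by apply: contraL db; apply: a_atomsNb.
    apply/esym/elementary_antichain; first by right; apply/b_atomsP.
      by left; exists c.
    by rewrite cE; apply: joins_sup; rewrite in_setI dB.
  - by rewrite (subset_trans _ BA) ?subsetIl.
  apply: contraNneq cJ => B0.
  by rewrite /bjoin B0 big_set0.
apply/forallP => D; apply/implyP => DB; apply/negP.
case/and3P=> /set0Pn[d dD] _ /forall_inP bel.
have below d' : d' \in D -> d' \in b_atoms xyU /\
    exists2 a, a \in a_atoms xyU & a <= \join_(e in D) e.
  move=> /bel /existsP[a /andP[_]]; rewrite andbA atom_le_lt.
  by case/andP=> /andP[aA d'b] /ltW aD; split=> //; exists a.
have [_ [_ /a_atomsP[c cx ->] le]] := below d dD.
suff : del c <= bjoin B by rewrite del_le // H.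
apply: (le_trans le); apply/joinsP => e eD; apply: joins_sup.
by rewrite in_setI (subsetP DB) //; case: (below e eD).
Qed.

Lemma is_shuffleP s : reflect (forall c, (c \in word s) = (c \in x) || (c \in y))
  (is_shuffle x y (word s)).
Proof.
apply: (iffP idP) => [/and3P[ps _ _] c|sE]; first by rewrite (perm_mem ps) mem_cat.
have sx : {subset x <= word s} by move=> c cx; rewrite sE cx.
have sy : {subset y <= word s} by move=> c cy; rewrite sE cy orbT.
apply/and3P; split.
- by apply: uniq_perm; rewrite ?word_uniq // => c; rewrite sE mem_cat.
- by rewrite -(x_determined sx).
- by have /leWP[_ _ ->] := lex1 s; apply/eqP/all_filterP/allP.
Qed.

Lemma in_B_ s d :
  (d \in B_ s) = (d \in a_atoms xyU) || (d \in b_atoms xyU) && (d <= s).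
Proof. by rewrite in_setU; congr orb; rewrite in_set. Qed.

Lemma nbb_base_shuffle B : nbb_base (@atom_le _ _ _ xyU) B (word_y xyU) ->
  exists2 s : W, is_shuffle x y (word s) & B = B_ s.
Proof.
case/andP=> /nbbP[BA xs] /eqP BY; pose s := bjoin B.
have bs b : b \in B -> b \in b_atoms xyU -> b <= s.
  by move=> bB bb; apply: joins_sup; rewrite in_setI bB.
(* Removing from [s] the letters deleted by the a-atoms of [B] gives an upper
   bound of [B]. *)
pose P c := (c \in y) || (del c \notin B).
have top : word_y xyU <= wfilter P s.
  rewrite -BY; apply/joinsP => d dB.
  have : d \in a_atoms xyU :|: b_atoms xyU by rewrite -atomsU (subsetP BA).
  case/setUP=> [/a_atomsP[c cx dE]|db].
    rewrite dE del_le // mem_wfilter negb_and /P negb_or negbK -dE dB andbT.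
    by apply/orP; left; apply/negP => /(xNy cx).
  by apply: le_wfilter => [|c cy _]; [apply: bs | rewrite /P cy].
have ys : {subset y <= word s}.
  by move=> c cy; have := le_memy top cy cy; rewrite mem_wfilter => /andP[].
have delB c : c \in x -> del c \in B.
  move=> cx; apply: contraT => cB.
  have /(xNy cx) [] : c \in y.
  by apply: (le_memx top cx); rewrite mem_wfilter /P cB orbT xs.
have sE : is_shuffle x y (word s).
  apply/is_shuffleP => c; apply/idP/idP; first exact: word_mem.
  by case/orP; [apply: xs | apply: ys].
exists s => //; apply/setP => d; rewrite in_B_.
apply/idP/orP => [dB|[/a_atomsP[c cx ->]|/andP[db ds]]].
- have : d \in a_atoms xyU :|: b_atoms xyU by rewrite -atomsU (subsetP BA).
  by case/setUP=> [->|db]; [left | right; rewrite db bs].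
- exact: delB.
have /b_atomsP[c cy dE] := db.
have [e eB ce] : exists2 e, e \in B :&: b_atoms xyU & c \in word e.
  (* Otherwise removing [c] from [s] gives a smaller upper bound of the
     b-atoms of [B]. *)
  apply/exists_inP; apply: contraT; rewrite negb_exists_in => /forall_inP nc.
  have : s <= wfilter (predC1 c) s.
    apply/joinsP => e eB; apply: le_wfilter => [|c' _ c'e].
      by case/setIP: eB; apply: bs.
    by apply: contraNneq (nc e eB) => <-.
  by move=> /le_memy/(_ cy (ys c cy)); rewrite mem_wfilter /= eqxx.
case/setIP: eB => eB eb; have /b_atomsP[c' c'y eE] := eb.
move: ce; rewrite eE inE => /orP[/eqP ec|/xNy[]//].
rewrite -ec in eE; suff -> : d = e by [].
apply: (inserts_le dE eE) ds (bs _ eB eb) => c''.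
by rewrite inE => /orP[/eqP->|/xs //]; apply: ys.
Qed.

Lemma shuffle_nbb_base s : is_shuffle x y (word s) ->
  nbb_base (@atom_le _ _ _ xyU) (B_ s) (word_y xyU).
Proof.
move/is_shuffleP=> sE.
have xs : {subset x <= word s} by move=> c cx; rewrite sE cx.
have sub : B_ s \subset atoms.
  apply/subsetP => b; rewrite in_B_ atomsU in_setU.
  by case/orP=> [->//|/andP[-> _]]; rewrite orbT.
apply/andP; split.
  apply/nbbP; split=> // c cx.
  suff /le_memx : bjoin (B_ s) <= s by apply; rewrite ?xs.
  apply/joinsP => b /setIP[]; rewrite in_B_.
  by case/orP=> [/a_atomsNb/negP nb /nb //|/andP[]].
rewrite eq_le lex1 /=; set J := \join_(b in _) b.
have ubJ d : d \in B_ s -> d <= J by apply: joins_sup.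
have xJ c : c \in x -> c \notin word J.
  move=> cx; rewrite -del_le //; apply: ubJ.
  by rewrite in_B_; apply/orP; left; apply/a_atomsP; exists c.
have yJ c : c \in y -> c \in word J.
  move=> cy; have cs : {subset c :: x <= word s}.
    by move=> e; rewrite inE => /orP[/eqP->|/xs //]; rewrite sE cy orbT.
  have ins := inserts_wfilter cs.
  have le : wfilter [in c :: x] s <= J.
    apply: ubJ; rewrite in_B_ wfilter_insert_le andbT.
    by apply/orP; right; apply/b_atomsP; exists c.
  by apply: (le_memy le cy); rewrite ins inE eqxx.
have JE : word_y xyU = J.
  apply: val_inj; have sY : {subset word J <= y}.
    by move=> c cJ; have := word_mem cJ; case/orP=> // /xJ; rewrite cJ.
  have /leWP[_ _ e] := lex1 J.
  transitivity (restrict y (word J)); first by apply/esym/all_filterP/allP.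
  by rewrite -e; apply/all_filterP/allP.
by rewrite {1}JE.
Qed.

End NBBBases.

Theorem theorem4p2 (T : eqType) (m n : nat) (x : m.-tuple T) (y : n.-tuple T)
    (xyU : uniq (x ++ y)) (B : {set shuffles xyU}) :
  nbb_base (@atom_le _ _ _ xyU) B (word_y xyU) <->
  exists2 s : shuffles xyU, is_shuffle x y (word s) & B = B_ s.
Proof.
split; first exact: nbb_base_shuffle.
by case=> s sE ->; apply: shuffle_nbb_base.
Qed.
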